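(* Let $\mathbb{K}$ be a field of characteristic $0$, let $d\geq2$, let $\{A_1,\dots,A_d\}$ and $\{E_1,\dots,E_d\}$ be two $d$-quadratic families of matrices over $\mathbb{K}$, and let $(\mathfrak{n}(A_1,\dots,A_d),\varphi_0)$ and $(\mathfrak{n}(E_1,\dots,E_d),\psi_0)$ be the quadratic Lie algebras attached to them. Then $(\mathfrak{n}(A_1,\dots,A_d),\varphi_0)$ and $(\mathfrak{n}(E_1,\dots,E_d),\psi_0)$ are isometrically isomorphic if and only if there exists an invertible $d\times d$ matrix $Q=(b_{ij})$ over $\mathbb{K}$ such that $$B(E_1,\dots,E_d)=Q^t\,B(A_1,\dots,A_d)\,\hat{Q},$$ where $\hat{Q}$ is the $\frac{d(d-1)}{2}\times\frac{d(d-1)}{2}$ matrix, with rows and columns indexed by the pairs $(r,s)$, $1\leq r<s\leq d$, in lexicographic order, whose entry in row $(r,s)$ and column $(i,j)$ is $$\det\begin{pmatrix} b_{ri}&b_{rj}\\ b_{si}&b_{sj}\end{pmatrix}.$$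
   Context: $d$-quadratic family: for $d\geq2$, an indexed family $\{A_1,\dots,A_d\}$ of $d\times d$ matrices over $\mathbb{K}$ is $d$-quadratic if: (1) every $A_i$ is skewsymmetric ($A_i^t=-A_i$); (2) the $i$-th column of $A_i$ is zero, for every $i$; (3) for all $j>i$, the $j$-th column of $A_i$ is the additive inverse of the $i$-th column of $A_j$; (4) if $B_{i<j}$ denotes the submatrix of $A_i$ formed by its columns $i+1,\dots,d$ (in order), then the $d\times\frac{d(d-1)}{2}$ matrix $B(A_1,\dots,A_d)=[B_{1<j}\,B_{2<j}\,\dots\,B_{d-1<j}]$ has rank $d$. Thus the columns of $B(A_1,\dots,A_d)$ are indexed by the pairs $(i,j)$ with $1\le i<j\le d$ in lexicographic order, the column $(i,j)$ being the $j$-th column of $A_i$. Attached quadratic Lie algebra: given a $d$-quadratic family $\{A_i=(a^i_{kj})\}$ ($a^i_{kj}$ the entry in row $k$, column $j$), $\mathfrak{n}(A_1,\dots,A_d)$ is the Lie algebra over $\mathbb{K}$ with basis $v_1,\dots,v_d,z_1,\dots,z_d$ and bracket $[v_i,v_j]=\sum_{k=1}^d a^i_{kj}z_k$, with all $z_i$ central. It carries the symmetric bilinear form (denoted $\varphi_0$, respectively $\psi_0$ for the family $\{E_i\}$) determined by $\varphi_0(v_i,z_j)=\delta_{ij}$ and $\varphi_0(v_i,v_j)=\varphi_0(z_i,z_j)=0$; with it, $\mathfrak{n}(A_1,\dots,A_d)$ is a quadratic Lie algebra, i.e. the form is symmetric, nondegenerate and satisfies $\varphi_0([x,y],z)+\varphi_0(y,[x,z])=0$.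 Two quadratic Lie algebras $(\mathfrak{g},\varphi)$ and $(\mathfrak{g}',\varphi')$ are isometrically isomorphic if there is a Lie algebra isomorphism $f\colon\mathfrak{g}\to\mathfrak{g}'$ with $\varphi'(f(x),f(y))=\varphi(x,y)$ for all $x,y\in\mathfrak{g}$. *)

(* Defs.v *)
From HB Require Import structures.
From mathcomp Require Import all_boot all_order all_algebra.

Set Implicit Arguments.
Unset Strict Implicit.
Unset Printing Implicit Defensive.

Import GRing.Theory.
Local Open Scope ring_scope.

Record lieAlgebra (K : fieldType) := LieAlgebra {
  lie_sort :> vectType K;
  bracket : lie_sort -> lie_sort -> lie_sort;
  bracket_linearr : forall x, linear (bracket x);
  bracket_linearl : forall y, linear (bracket^~ y);
  bracket_alt : forall x, bracket x x = 0;
  bracket_jacobi : forall x y z,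
    bracket x (bracket y z) + bracket y (bracket z x)
      + bracket z (bracket x y) = 0
}.

Record quadLieAlgebra (K : fieldType) := QuadLieAlgebra {
  quad_lie :> lieAlgebra K;
  form : quad_lie -> quad_lie -> K;
  form_linearr : forall x, scalar (form x);
  form_linearl : forall y, scalar (form^~ y);
  form_sym : forall x y, form x y = form y x;
  form_nondeg : forall x, (forall y, form x y = 0) -> x = 0;
  form_inv : forall x y z, form (bracket x y) z + form y (bracket x z) = 0
}.

Definition lie_isomorphism (K : fieldType) (g g' : lieAlgebra K)
    (f : {linear g -> g'}) :=
  bijective f /\ forall x y, f (bracket x y) = bracket (f x) (f y).

Definition isometrically_isomorphic (K : fieldType) (g g' : quadLieAlgebra K) :=
  exists f : {linear g -> g'},
    lie_isomorphism f /\ forall x y, form (f x) (f y) = form x y.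

(* Matrix indices are 0-based throughout. *)
Definition lexpairs_seq (d : nat) : seq ('I_d * 'I_d) :=
  [seq (i, j) | i : 'I_d <- enum 'I_d,
                j : 'I_d <- [seq j : 'I_d <- enum 'I_d | (i < j)%N]].

Lemma size_lexpairs d : size (lexpairs_seq d) == (d * d.-1)./2.
Proof.
rewrite -bin2 -bin2_sum big_mkord -sum1_size big_allpairs_dep /=.
under eq_bigr => i _ do rewrite big_filter.
rewrite big_enum /=.
under eq_bigr => i _ do rewrite big_enum_cond /=.
rewrite (exchange_big_dep xpredT) //=.
apply/eqP; apply: eq_bigr => j _.
by rewrite (big_ord_narrow (ltnW (ltn_ord j))) sum1_card card_ord.
Qed.

(* The pairs (i, j) with i < j, in lexicographic order. *)
Definition lexpairs (d : nat) : ((d * d.-1)./2).-tuple ('I_d * 'I_d) :=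
  Tuple (size_lexpairs d).

Definition Bmx (K : fieldType) (d : nat) (A : 'I_d -> 'M[K]_d)
    : 'M[K]_(d, (d * d.-1)./2) :=
  \matrix_(k, c) A (tnth (lexpairs d) c).1 k (tnth (lexpairs d) c).2.

(* The second compound matrix of Q: its entry in row (r, s) and column (i, j)
   is the minor of Q on rows r, s and columns i, j. *)
Definition hatmx (K : fieldType) (d : nat) (Q : 'M[K]_d)
    : 'M[K]_((d * d.-1)./2) :=
  \matrix_(p, q)
    let: (r, s) := tnth (lexpairs d) p in
    let: (i, j) := tnth (lexpairs d) q in
    \det (mxsub (tnth [tuple r; s]) (tnth [tuple i; j]) Q).

Lemma hatmxE (K : fieldType) (d : nat) (Q : 'M[K]_d) p q :
  let: (r, s) := tnth (lexpairs d) p in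
  let: (i, j) := tnth (lexpairs d) q in
  hatmx Q p q = Q r i * Q s j - Q r j * Q s i.
Proof.
rewrite mxE; case: (tnth _ p) => r s; case: (tnth _ q) => i j.
rewrite (expand_det_row _ ord0) !big_ord_recl big_ord0 /cofactor !det_mx11.
rewrite !mxE /= !(tnth_nth r, tnth_nth i) /=.
by rewrite addr0 expr0 expr1 mul1r mulN1r mulrN.
Qed.

Definition quadratic_family (K : fieldType) (d : nat) (A : 'I_d -> 'M[K]_d) :=
  [/\ forall i, (A i)^T = - A i,
      forall i, col i (A i) = 0,
      forall i j : 'I_d, (i < j)%N -> col j (A i) = - col i (A j) &
      \rank (Bmx A) = d].

Section AttachedAlgebra.

Variables (K : fieldType) (d : nat) (A : 'I_d -> 'M[K]_d).

(* (x, z) stands for \sum_i x_i v_i + \sum_k z_k z_k, see nA_decomp below. *)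
Local Notation carrier := ('cV[K]_d * 'cV[K]_d)%type.

Definition nA_v (i : 'I_d) : carrier := (delta_mx i 0, 0).
Definition nA_z (i : 'I_d) : carrier := (0, delta_mx i 0).

Definition nA_bracket (u w : carrier) : carrier :=
  \sum_i \sum_j (u.1 i 0 * w.1 j 0) *: (\sum_k A i k j *: nA_z k).

Definition nA_form (u w : carrier) : K :=
  \sum_i (u.1 i 0 * w.2 i 0 + u.2 i 0 * w.1 i 0).

Lemma nA_decomp (u : carrier) :
  u = \sum_i u.1 i 0 *: nA_v i + \sum_k u.2 k 0 *: nA_z k.
Proof.
have sumE (F : 'I_d -> carrier) :
    \sum_i F i = (\sum_i (F i).1, \sum_i (F i).2).
  by apply: (big_ind3 (fun a b c => a = (b, c)))
      => [||i _] //; [move=> ? ? ? ? ? ? -> -> | case: (F i)].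
have cE (x : 'cV[K]_d) : \sum_i x i 0 *: delta_mx i 0 = x.
  rewrite [RHS]matrix_sum_delta; apply: eq_bigr => i _.
  by rewrite big_ord1.
case: u => x z; rewrite !sumE /= !cE.
rewrite (big1 _ _ (fun i => z i 0 *: 0)); last by move=> i _; rewrite scaler0.
rewrite (big1 _ _ (fun i => x i 0 *: 0)); last by move=> i _; rewrite scaler0.
by congr pair; rewrite ?addr0 ?add0r.
Qed.

Lemma nA_bracketvv i j :
  nA_bracket (nA_v i) (nA_v j) = \sum_k A i k j *: nA_z k.
Proof.
rewrite /nA_bracket (bigD1 i) //= [X in _ + X]big1 ?addr0; last first.
  move=> i' /negPf ii'; apply: big1 => j' _.
  by rewrite /= !mxE ii' mul0r scale0r.
rewrite (bigD1 j) //= [X in _ + X]big1 ?addr0; last first.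
  by move=> j' /negPf jj'; rewrite /= !mxE jj' mulr0 scale0r.
by rewrite /= !mxE !eqxx mulr1 scale1r.
Qed.

Lemma nA_bracketzl k u : nA_bracket (nA_z k) u = 0.
Proof.
by apply: big1 => i _; apply: big1 => j _; rewrite /= !mxE mul0r scale0r.
Qed.

Lemma nA_bracketzr k u : nA_bracket u (nA_z k) = 0.
Proof.
by apply: big1 => i _; apply: big1 => j _; rewrite /= !mxE mulr0 scale0r.
Qed.

Lemma nA_formvz i j : nA_form (nA_v i) (nA_z j) = (i == j)%:R.
Proof.
rewrite /nA_form (bigD1 i) //= big1 => [|i' /negPf ii'].
  by rewrite /= !mxE !eqxx mul1r mul0r !addr0 andbT.
by rewrite /= !mxE ii' !mul0r addr0.
Qed.

Lemma nA_formvv i j : nA_form (nA_v i) (nA_v j) = 0.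
Proof. by apply: big1 => k _; rewrite /= !mxE mulr0 mul0r addr0. Qed.

Lemma nA_formzz i j : nA_form (nA_z i) (nA_z j) = 0.
Proof. by apply: big1 => k _; rewrite /= !mxE mulr0 mul0r addr0. Qed.

Lemma nA_bracketE u w :
  nA_bracket u w = (0, \sum_i u.1 i 0 *: (A i *m w.1)).
Proof.
have sumE (F : 'I_d -> carrier) :
    \sum_i F i = (\sum_i (F i).1, \sum_i (F i).2).
  by apply: (big_ind3 (fun a b c => a = (b, c)))
      => [||i _] //; [move=> ? ? ? ? ? ? -> -> | case: (F i)].
rewrite /nA_bracket sumE; congr pair.
  apply: big1 => i _; rewrite sumE /=; apply: big1 => j _.
  by rewrite sumE /= big1 ?scaler0 // => k _; rewrite scaler0.
apply: eq_bigr => i _; rewrite sumE /=; apply/colP => k.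
rewrite summxE !mxE mulr_sumr; apply: eq_bigr => j _.
rewrite sumE /= !mxE summxE (bigD1 k) //= big1 => [|k' /negPf kk'].
  by rewrite /= !mxE !eqxx mulr1 addr0 -!mulrA (mulrC (w.1 j 0)).
by rewrite /= !mxE eq_sym kk' mulr0.
Qed.

Hypothesis hA : quadratic_family A.

Lemma nA_bracket_linearr u : linear (nA_bracket u).
Proof.
move=> a w w'; rewrite !nA_bracketE /=.
congr pair; first by rewrite /= scaler0 addr0.
rewrite /= scaler_sumr -big_split; apply: eq_bigr => i _ /=.
by rewrite mulmxDr scalerDr -scalemxAr !scalerA mulrC.
Qed.

Lemma nA_bracket_linearl w : linear (nA_bracket^~ w).
Proof.
move=> a u u'; rewrite !nA_bracketE /=.
congr pair; first by rewrite /= scaler0 addr0.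
rewrite /= scaler_sumr -big_split; apply: eq_bigr => i _ /=.
by rewrite /= !mxE scalerDl scalerA.
Qed.

Lemma nA_bracket_alt u : nA_bracket u u = 0.
Proof.
have [_ h2 h3 _] := hA.
rewrite nA_bracketE; congr pair; apply/colP => k; rewrite summxE mxE.
under eq_bigr => i _ do rewrite /= !mxE mulr_sumr.
have swapK : involutive (fun p : 'I_d * 'I_d => (p.2, p.1)) by case.
rewrite pair_big /= (bigID (fun p : 'I_d * 'I_d => (p.1 < p.2)%N)) /=.
rewrite [X in _ + X](bigID (fun p : 'I_d * 'I_d => (p.2 < p.1)%N)) /=.
rewrite [X in _ + (_ + X)]big1 ?addr0; last first.
  case=> i j /=; rewrite -!leqNgt => /andP[ji ij].
  have -> : j = i by apply/val_inj/eqP; rewrite eqn_leq ji ij.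
  by have /colP/(_ k) := h2 i; rewrite /= !mxE => ->; rewrite mul0r mulr0.
rewrite [X in _ + X](reindex_inj (inv_inj swapK)) /=.
rewrite [X in _ + X](eq_bigl (fun p : 'I_d * 'I_d => (p.1 < p.2)%N)); last first.
  by case=> i j /=; case: ltngtP.
rewrite -big_split big1 // => -[i j] /= ij.
have /colP/(_ k) := h3 i j ij; rewrite /= !mxE => ->.
by rewrite mulNr mulrN mulrCA [u.1 i 0 * _]mulrC [X in _ + X]mulrCA addNr.
Qed.

Lemma nA_bracket_jacobi u v w :
  nA_bracket u (nA_bracket v w) + nA_bracket v (nA_bracket w u)
    + nA_bracket w (nA_bracket u v) = 0.
Proof.
have br0 x y z : nA_bracket x (nA_bracket y z) = 0.
  rewrite nA_bracketE [nA_bracket y z]nA_bracketE /=; congr pair.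
  by apply: big1 => i _; rewrite mulmx0 scaler0.
by rewrite !br0 !addr0.
Qed.

Definition attached_lie : lieAlgebra K :=
  @LieAlgebra K carrier nA_bracket nA_bracket_linearr nA_bracket_linearl
    nA_bracket_alt nA_bracket_jacobi.

Lemma nA_form_sym u w : nA_form u w = nA_form w u.
Proof.
by apply: eq_bigr => i _; rewrite addrC mulrC [X in _ + X]mulrC.
Qed.

Lemma nA_form_linearr u : scalar (nA_form u).
Proof.
move=> a w w'; rewrite /nA_form mulr_sumr -big_split.
apply: eq_bigr => i _; rewrite /= !mxE !mulrDr addrACA.
by congr (_ + _ + _); rewrite mulrCA.
Qed.

Lemma nA_form_linearl w : scalar (nA_form^~ w).
Proof.
by move=> a u u'; rewrite !(nA_form_sym _ w) nA_form_linearr.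
Qed.

Lemma nA_form_nondeg u : (forall w, nA_form u w = 0) -> u = 0.
Proof.
move=> u0; case: u u0 => x z u0; congr pair; apply/colP => i; rewrite mxE.
  have := u0 (nA_z i); rewrite /nA_form (bigD1 i) //= big1 => [|j /negPf ij].
    by rewrite /= !mxE !eqxx mulr1 mulr0 !addr0.
  by rewrite /= !mxE ij !mulr0 addr0.
have := u0 (nA_v i); rewrite /nA_form (bigD1 i) //= big1 => [|j /negPf ij].
  by rewrite /= !mxE !eqxx mulr1 mulr0 add0r addr0.
by rewrite /= !mxE ij !mulr0 addr0.
Qed.

Lemma nA_form_inv u v w :
  nA_form (nA_bracket u v) w + nA_form v (nA_bracket u w) = 0.
Proof.
have [h1 _ _ _] := hA.
have skew i k j : A i k j = - A i j k.
  by have /matrixP/(_ j k) := h1 i; rewrite /= !mxE.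
rewrite !nA_bracketE /nA_form /=.
under eq_bigr => k _ do rewrite mxE mul0r add0r summxE mulr_suml.
under [X in _ + X]eq_bigr => k _ do
  rewrite mxE mulr0 addr0 summxE mulr_sumr.
rewrite exchange_big [X in _ + X]exchange_big -big_split big1 //= => i _.
under eq_bigr => k _ do rewrite /= !mxE mulr_sumr mulr_suml.
under [X in _ + X]eq_bigr => k _ do rewrite /= !mxE !mulr_sumr.
rewrite exchange_big -big_split big1 //= => j _.
rewrite -big_split big1 //= => k _.
rewrite (skew i k j) mulNr mulrN mulNr; apply/eqP; rewrite addrC subr_eq0.
by apply/eqP; rewrite mulrCA -!mulrA; congr (_ * _); rewrite mulrCA.
Qed.

Definition attached_quadLie : quadLieAlgebra K :=
  @QuadLieAlgebra K attached_lie nA_form nA_form_linearr nA_form_linearl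
    nA_form_sym nA_form_nondeg nA_form_inv.

End AttachedAlgebra.

(* Main.v *)
Require Import Defs.
From HB Require Import structures.
From mathcomp Require Import all_boot all_order all_algebra.

Import GRing.Theory.
Local Open Scope ring_scope.

(** Let [beta A x y := \sum_i x_i A_i y] be the z-component of the bracket of
    [n(A)]. The right-hand side of the matrix equation is the matrix [Bmx] of
    the family [congr_family Q A], whose [beta] is
    [(x, y) |-> Q^T beta A (Q x) (Q y)]; as an alternating family is determined
    by its matrix [Bmx], the equation says [beta E x y = Q^T beta A (Q x) (Q y)].
    Given such a [Q], the map [(x, z) |-> (Q^-1 x, Q^T z)] is an isometric
    isomorphism. Conversely, [Bmx A] having rank [d], the z-part is the derived
    algebra, so an isomorphism has the form [(x, z) |-> (P x, R x + G z)];
    isometry gives [P^T G = 1], hence [Q := P^-1] works. *)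

Section AlternatingFamilies.

Local Set Implicit Arguments.
Local Unset Strict Implicit.

Variables (K : fieldType) (d : nat).
Implicit Types (A E : 'I_d -> 'M[K]_d) (Q : 'M[K]_d) (x y : 'cV[K]_d).

(** * The bilinear map of a family and its change of basis *)

Definition beta A x y : 'cV[K]_d := \sum_i x i 0 *: (A i *m y).

Definition alternating A := forall x, beta A x x = 0.

Definition congr_family Q A (i : 'I_d) : 'M[K]_d :=
  Q^T *m (\sum_r Q r i *: A r) *m Q.

Lemma quadratic_alternating A : quadratic_family A -> alternating A.
Proof.
move=> hA x; have := nA_bracket_alt hA (x, 0).
by rewrite nA_bracketE => /(congr1 snd).
Qed.

Lemma beta_delta A i j : beta A (delta_mx i 0) (delta_mx j 0) = col j (A i).
Proof.
rewrite /beta (bigD1 i) //= big1 => [|i' /negPf ii'].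
  by rewrite mxE !eqxx scale1r addr0 colE.
by rewrite mxE ii' scale0r.
Qed.

Lemma betaDl A x x' y : beta A (x + x') y = beta A x y + beta A x' y.
Proof.
by rewrite /beta -big_split; apply: eq_bigr => i _; rewrite mxE scalerDl.
Qed.

Lemma betaDr A x y y' : beta A x (y + y') = beta A x y + beta A x y'.
Proof.
by rewrite /beta -big_split; apply: eq_bigr => i _; rewrite mulmxDr scalerDr.
Qed.

Lemma alternating_beta_skew A x y :
  alternating A -> beta A x y = - beta A y x.
Proof.
move=> altA; have := altA (x + y); rewrite betaDl !betaDr !altA add0r addr0.
by move/eqP; rewrite addr_eq0 => /eqP.
Qed.

Lemma alternating_skew A i j k : alternating A -> A i k j = - A j k i.
Proof.
move=> altA; have := alternating_beta_skew (delta_mx i 0) (delta_mx j 0) altA.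
by rewrite !beta_delta => /colP/(_ k); rewrite !mxE.
Qed.

Lemma alternating_diag A i k : alternating A -> A i k i = 0.
Proof.
move=> altA; have := altA (delta_mx i 0).
by rewrite beta_delta => /colP/(_ k); rewrite !mxE.
Qed.

Lemma beta_congr_family Q A x y :
  beta (congr_family Q A) x y = Q^T *m beta A (Q *m x) (Q *m y).
Proof.
rewrite /beta /congr_family mulmx_sumr.
under eq_bigr => i _ do
  rewrite mulmx_sumr !mulmx_suml scaler_sumr.
rewrite exchange_big; apply: eq_bigr => r _ /=.
rewrite mxE scaler_suml mulmx_sumr; apply: eq_bigr => i _.
by rewrite -!scalemxAr -!scalemxAl scalerA mulrC !mulmxA.
Qed.

Lemma alternating_congr_family Q A :
  alternating A -> alternating (congr_family Q A).
Proof. by move=> altA x; rewrite beta_congr_family altA mulmx0. Qed.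

Lemma beta_inj A E : (forall x y, beta A x y = beta E x y) -> A =1 E.
Proof.
move=> AE i; apply/matrixP => k j.
have := AE (delta_mx i 0) (delta_mx j 0).
by rewrite !beta_delta => /colP/(_ k); rewrite !mxE.
Qed.

Lemma eq_beta A E x y : A =1 E -> beta A x y = beta E x y.
Proof. by move=> AE; apply: eq_bigr => i _; rewrite AE. Qed.

(** * Families and their matrices [Bmx] *)

Lemma eq_Bmx A E : A =1 E -> Bmx A = Bmx E.
Proof. by move=> AE; apply/matrixP => k c; rewrite !mxE AE. Qed.

Lemma mem_lexpairs (i j : 'I_d) : (i < j)%N -> (i, j) \in lexpairs d.
Proof.
move=> ij; apply/allpairsPdep; exists i, j.
by rewrite mem_enum mem_filter ij mem_enum.
Qed.

(** [Bmx] records the entries [A i k j] with [i < j]; skewness recovers those with [j < i], and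
    alternation kills those with [i = j]. *)
Lemma Bmx_inj A E : alternating A -> alternating E -> Bmx A = Bmx E -> A =1 E.
Proof.
move=> altA altE AE.
have lt_eq (i j k : 'I_d) : (i < j)%N -> A i k j = E i k j.
  move=> /mem_lexpairs/tnthP[c ijc].
  by have /matrixP/(_ k c) := AE; rewrite !mxE -ijc.
move=> i; apply/matrixP => k j; case: (ltngtP i j) => [||ij].
- exact: lt_eq.
- by move=> ji; rewrite (alternating_skew _ _ _ altA) lt_eq // -alternating_skew.
- by rewrite -(val_inj ij) !alternating_diag.
Qed.

(** * Second compound matrix and congruence *)

Lemma sum_lexpairs (F : 'I_d * 'I_d -> K) :
  \sum_p F (tnth (lexpairs d) p) = \sum_(p : 'I_d * 'I_d | (p.1 < p.2)%N) F p.
Proof.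
rewrite -(big_tuple _ _ _ xpredT F) big_allpairs_dep /= big_enum /=.
under eq_bigr => i _ do rewrite big_filter big_enum_cond /=.
by rewrite pair_big_dep; apply: eq_bigr => -[].
Qed.

(** Folds the square of index pairs along its diagonal, pairing [(r, s)] with [(s, r)]. When [M r s]
    is a product of entries from two columns of [Q], the difference of the [M] terms is a 2 x 2
    minor. *)
Lemma sum_skew (G M : 'I_d -> 'I_d -> K) :
    (forall r, G r r = 0) -> (forall r s, G r s = - G s r) ->
  \sum_r \sum_s G r s * M r s =
  \sum_(p : 'I_d * 'I_d | (p.1 < p.2)%N)
    G p.1 p.2 * (M p.1 p.2 - M p.2 p.1).
Proof.
move=> G0 GN; have swapK : involutive (fun p : 'I_d * 'I_d => (p.2, p.1)) by case.
rewrite pair_big /= (bigID (fun p : 'I_d * 'I_d => (p.1 < p.2)%N)) /=.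
rewrite [X in _ + X](bigID (fun p : 'I_d * 'I_d => (p.2 < p.1)%N)) /=.
rewrite [X in _ + (_ + X)]big1 ?addr0; last first.
  case=> i j /=; rewrite -!leqNgt => /andP[ji ij].
  have -> : j = i by apply/val_inj/eqP; rewrite eqn_leq ji ij.
  by rewrite G0 mul0r.
rewrite [X in _ + X](reindex_inj (inv_inj swapK)) /=.
rewrite [X in _ + X](eq_bigl (fun p : 'I_d * 'I_d => (p.1 < p.2)%N)); last first.
  by case=> i j /=; case: ltngtP.
by rewrite -big_split; apply: eq_bigr => p _; rewrite /= (GN p.2) mulNr mulrBr.
Qed.

Lemma hatmx_minor Q p q :
  let r := tnth (lexpairs d) p in let i := tnth (lexpairs d) q in
  hatmx Q p q = Q r.1 i.1 * Q r.2 i.2 - Q r.1 i.2 * Q r.2 i.1.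
Proof.
by have := hatmxE Q p q; case: (tnth _ p) => r s; case: (tnth _ q) => i j.
Qed.

(** Column [(i, j)] on the left is [Q^T] applied to [beta A] of columns [i] and [j] of [Q].
    Expanding this value bilinearly and folding by skewness leaves the columns of [Bmx A] weighted
    by minors, the entries of [hatmx Q]. *)
Lemma Bmx_congr_family Q A :
  alternating A -> Bmx (congr_family Q A) = Q^T *m Bmx A *m hatmx Q.
Proof.
move=> altA; apply/matrixP => k c; rewrite -mulmxA [LHS]mxE.
set i := (tnth _ c).1; set j := (tnth _ c).2.
have -> : congr_family Q A i k j = (Q^T *m beta A (col i Q) (col j Q)) k 0.
  by rewrite !colE -beta_congr_family beta_delta [RHS]mxE.
(* With the common factor [Q^T] removed, it remains to compare the [l]-th coordinates. *)
rewrite mxE [RHS]mxE; apply: eq_bigr => l _; congr (_ * _).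
rewrite [RHS]mxE.
under [RHS]eq_bigr => p _ do rewrite mxE hatmx_minor -/i -/j.
rewrite (sum_lexpairs (fun r => A r.1 l r.2 *
  (Q r.1 i * Q r.2 j - Q r.1 j * Q r.2 i))).
rewrite summxE; under eq_bigr => r _ do rewrite !mxE mulr_sumr.
under eq_bigr => r _ do under eq_bigr => s _ do rewrite mxE mulrCA.
rewrite (@sum_skew (fun r s => A r l s) (fun r s => Q r i * Q s j)) /=.
- by apply: eq_bigr => p _; rewrite [Q p.2 i * _]mulrC.
- by move=> r; apply: alternating_diag.
- by move=> r s; apply: alternating_skew.
Qed.

Lemma Bmx_eq_congr Q A E : alternating A -> alternating E ->
  Bmx E = Q^T *m Bmx A *m hatmx Q <->
  forall x y, beta E x y = Q^T *m beta A (Q *m x) (Q *m y).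
Proof.
move=> altA altE; rewrite -Bmx_congr_family //; split=> [EA x y | EA].
  rewrite -beta_congr_family; apply: eq_beta; apply: Bmx_inj => //.
  exact: alternating_congr_family.
by apply/eq_Bmx/beta_inj => x y; rewrite beta_congr_family.
Qed.

(** * From an isometry to a congruence *)

Lemma bracket_beta A (u w : 'cV[K]_d * 'cV[K]_d) :
  nA_bracket A u w = (0, beta A u.1 w.1).
Proof. exact: nA_bracketE. Qed.

Lemma form_mulmx (u w : 'cV[K]_d * 'cV[K]_d) :
  nA_form u w = (u.1^T *m w.2 + u.2^T *m w.1) 0 0.
Proof.
rewrite !mxE -big_split; apply: eq_bigr => i _ /=.
by rewrite !mxE.
Qed.

(** Takes a plain function with a linearity proof, so that it applies directly to the block
    components of an isomorphism. *)
Lemma linear_cV_mulmx m n (g : 'cV[K]_m -> 'cV[K]_n) :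
  linear g -> exists P : 'M[K]_(n, m), forall x : 'cV[K]_m, g x = P *m x.
Proof.
move=> lin_g.
pose gL : {linear 'cV[K]_m -> 'cV[K]_n} :=
  HB.pack g (GRing.isLinear.Build _ _ _ _ g lin_g).
exists (\matrix_(i, j) g (delta_mx j 0) i 0) => x.
have gE : g =1 gL by [].
rewrite gE [in LHS](matrix_sum_delta x) linear_sum.
apply/colP => i; rewrite summxE mxE; apply: eq_bigr => j _.
by rewrite big_ord1 linearZ !mxE gE mulrC.
Qed.

Lemma delta_mulmx_delta (M : 'M[K]_d) i j :
  ((delta_mx i 0 : 'cV[K]_d)^T *m (M *m (delta_mx j 0 : 'cV[K]_d))) 0 0 = M i j.
Proof. by rewrite trmx_delta -rowE -colE !mxE. Qed.

Let carrier := ('cV[K]_d * 'cV[K]_d)%type.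

Lemma isometry_congr A E (f : carrier -> carrier) :
    linear f -> \rank (Bmx A) = d ->
    (forall u w, f (nA_bracket A u w) = nA_bracket E (f u) (f w)) ->
    (forall u w, nA_form (f u) (f w) = nA_form u w) ->
  exists Q, Q \in unitmx /\
    forall x y, beta E x y = Q^T *m beta A (Q *m x) (Q *m y).
Proof.
move=> lin_f rkA f_br f_form.
have pair0l a (z z' : 'cV[K]_d) :
    (0, a *: z + z') = a *: ((0, z) : carrier) + (0, z').
  by congr pair; rewrite /= scaler0 addr0.
have pair0r a (z z' : 'cV[K]_d) :
    (a *: z + z', 0) = a *: ((z, 0) : carrier) + (z', 0).
  by congr pair; rewrite /= scaler0 addr0.
(* [P], [N] and [G] are the blocks of [f] from v-part to v-part, from z-part to v-part and from
   z-part to z-part. *)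
have [|P PE] := @linear_cV_mulmx d d (fun x => (f (x, 0)).1).
  by move=> a x x'; rewrite pair0r lin_f.
have [|N NE] := @linear_cV_mulmx d d (fun z => (f (0, z)).1).
  by move=> a x x'; rewrite pair0l lin_f.
have [|G GE] := @linear_cV_mulmx d d (fun z => (f (0, z)).2).
  by move=> a x x'; rewrite pair0l lin_f.
(* [f] sends brackets to brackets, and these have no v-component. *)
have Nbeta x y : N *m beta A x y = 0.
  by rewrite -NE -(bracket_beta A (x, 0) (y, 0)) f_br bracket_beta.
(* The columns of [Bmx A] are values of [beta A], so [N] kills them; full row rank gives a right
   inverse [D] that cancels [Bmx A]. *)
have N0 : N = 0.
  have /row_freeP[D BD] : row_free (Bmx A) by rewrite /row_free rkA.
  suff NB : N *m Bmx A = 0 by rewrite -[N]mulmx1 -BD mulmxA NB mul0mx.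
  apply/matrixP => k c; rewrite [RHS]mxE.
  set i := (tnth (lexpairs d) c).1; set j := (tnth (lexpairs d) c).2.
  have := Nbeta (delta_mx i 0) (delta_mx j 0).
  rewrite beta_delta => /colP/(_ k); rewrite [RHS]mxE => <-.
  by rewrite !mxE; apply: eq_bigr => l _; rewrite !mxE.
have fz z : f (0, z) = (0, G *m z).
  by rewrite -GE; case: (f (0, z)) (NE z) => a b /= ->; rewrite N0 mul0mx.
(* Pair the images of a v-vector and a z-vector: the z-component of the former meets the zero
   v-component of the latter, leaving only [P] and [G]. *)
have PG : P^T *m G = 1%:M.
  apply/matrixP => i j; rewrite -delta_mulmx_delta -[RHS]delta_mulmx_delta.
  have := f_form (delta_mx i 0, 0) (0, delta_mx j 0).
  rewrite !form_mulmx fz /= PE !mulmx0 !addr0 mul1mx => <-.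
  by rewrite trmx_mul !mulmxA.
have [PTu Gu] := mulmx1_unit PG.
have Pu : P \in unitmx by rewrite -unitmx_tr.
have GP : G = (invmx P)^T.
  by rewrite trmx_inv -[G]mul1mx -(mulVmx PTu) -mulmxA PG mulmx1.
exists (invmx P); split=> [|x y]; first by rewrite unitmx_inv.
(* The right-hand side is the z-component of the image of a bracket, whose two arguments [f] maps to
   vectors with v-parts [x] and [y]. *)
rewrite -GP -GE -(bracket_beta A (invmx P *m x, 0) (invmx P *m y, 0)) f_br.
by rewrite bracket_beta /= !PE !mulKVmx.
Qed.

(** * From a congruence to an isometry *)

Definition congr_iso Q (u : carrier) : carrier := (invmx Q *m u.1, Q^T *m u.2).

Lemma congr_iso_linear Q : linear (congr_iso Q).
Proof.
by move=> a u w; congr pair; rewrite /= mulmxDr -scalemxAr.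
Qed.

Lemma congr_iso_bij Q : Q \in unitmx -> bijective (congr_iso Q).
Proof.
move=> Qu; have QTu : Q^T \in unitmx by rewrite unitmx_tr.
exists (fun u : carrier => (Q *m u.1, invmx Q^T *m u.2)) => -[x z].
  by rewrite /congr_iso /= mulKVmx // mulKmx.
by rewrite /congr_iso /= mulKmx // mulKVmx.
Qed.

Lemma congr_iso_bracket Q A E : Q \in unitmx ->
    (forall x y, beta E x y = Q^T *m beta A (Q *m x) (Q *m y)) ->
  forall u w, congr_iso Q (nA_bracket A u w) =
    nA_bracket E (congr_iso Q u) (congr_iso Q w).
Proof.
move=> Qu EA u w.
by rewrite !bracket_beta /congr_iso /= EA !mulKVmx // mulmx0.
Qed.

(** The two diagonal blocks are contragredient: [Q^T] is the inverse transpose of [invmx Q], so the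
    pairing of v-parts with z-parts is preserved. *)
Lemma congr_iso_form Q : Q \in unitmx ->
  forall u w, nA_form (congr_iso Q u) (congr_iso Q w) = nA_form u w.
Proof.
move=> Qu u w; rewrite !form_mulmx /congr_iso /= !trmx_mul trmxK.
rewrite -!mulmxA !mulKVmx // trmx_inv mulKmx //.
by rewrite unitmx_tr.
Qed.

End AlternatingFamilies.

Theorem theorem13 (K : fieldType) (charK0 : [pchar K] =i pred0)
    (d : nat) (d_ge2 : (2 <= d)%N) (A E : 'I_d -> 'M[K]_d)
    (hA : quadratic_family A) (hE : quadratic_family E) :
  isometrically_isomorphic (attached_quadLie hA) (attached_quadLie hE) <->
  exists Q : 'M[K]_d,
    Q \in unitmx /\ Bmx E = Q^T *m Bmx A *m hatmx Q.
Proof.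
have altA := quadratic_alternating hA; have altE := quadratic_alternating hE.
split=> [[f [[_ f_br] f_form]] | [Q [Qu /(Bmx_eq_congr _ altA altE) EA]]].
  have [_ _ _ rkA] := hA.
  have [Q [Qu EA]] := isometry_congr (@linearP _ _ _ _ f) rkA f_br f_form.
  by exists Q; split=> //; apply/Bmx_eq_congr.
pose f : {linear attached_quadLie hA -> attached_quadLie hE} :=
  HB.pack (congr_iso Q)
    (GRing.isLinear.Build _ _ _ _ (congr_iso Q) (congr_iso_linear Q)).
exists f; split; last exact: congr_iso_form.
by split; [exact: congr_iso_bij | exact: congr_iso_bracket].
Qed.
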